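(* Let $A,B$ be real symmetric $2\times2$ matrices and $F_H(x)=(\langle Ax,x\rangle,\langle Bx,x\rangle)$ for $x\in\mathbb{R}^2$. The following statements are equivalent: (a) SD holds for $A$ and $B$; (b) there exist $u,v\in\mathbb{R}^2$ such that $F_H(\mathbb{R}^2)=\mathbb{R}_+u+\mathbb{R}_+v$; (c) $F_H(\mathbb{R}^2)$ is closed and $F_H(\mathbb{R}^2)\ne\mathbb{R}^2$.
   Context: SD (simultaneous diagonalization) holds for $A$ and $B$ if there exists a nonsingular real matrix $C$ such that both $C^\top AC$ and $C^\top BC$ are diagonal. $\mathbb{R}_+u=\{tu: t\ge0\}$; the vectors $u,v$ may be linearly dependent or zero. *)

(* Defs.v *)
From mathcomp Require Import all_boot all_order all_algebra.
From mathcomp Require Import all_classical all_reals all_analysis.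

Set Implicit Arguments.
Unset Strict Implicit.
Unset Printing Implicit Defensive.

Import Order.TTheory GRing.Theory Num.Theory.
Import numFieldNormedType.Exports.

Local Open Scope classical_set_scope.
Local Open Scope ring_scope.

Definition dotv (R : realType) (n : nat) (x y : 'cV[R]_n) : R :=
  \sum_(i < n) x i 0 * y i 0.

Definition FH (R : realType) (A B : 'M[R]_2) (x : 'cV[R]_2) : 'cV[R]_2 :=
  \col_(i < 2) (if i == 0 then dotv (A *m x) x else dotv (B *m x) x).

Definition SD (R : realType) (n : nat) (A B : 'M[R]_n) : Prop :=
  exists C : 'M[R]_n,
    [/\ C \in unitmx, is_diag_mx (C^T *m A *m C)
      & is_diag_mx (C^T *m B *m C)].

Definition ray (R : realType) (n : nat) (u : 'cV[R]_n) : set 'cV[R]_n :=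
  [set t *: u | t in [set t : R | 0 <= t]].

Definition minkowski_sum (R : realType) (n : nat) (X Y : set 'cV[R]_n) :
    set 'cV[R]_n :=
  [set x + y | x in X & y in Y].

(* Main.v *)
Require Import Defs.
From mathcomp Require Import all_boot all_order all_algebra.
From mathcomp Require Import all_classical all_reals all_analysis.
From mathcomp Require Import ring lra.

(* Write A = [[a, b], [b, c]] and B = [[a', b'], [b', c']].  The cross product
   (p, q, r) of (a, 2b, c) and (a', 2b', c') is, as a symmetric matrix
   S = [[p, q], [q, r]], orthogonal to A and B for the trace pairing, and SD
   amounts to a basis (w, z) of the plane with <Aw, z> = <Bw, z> = 0, i.e. to
   an indefinite matrix w z^T + z w^T orthogonal to both.
   - If det S < 0, then S factors in this way; if S = 0, then A and B are
     dependent, and a trace-free matrix orthogonal to both does.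
   - If det S > 0, then the matrices M with (tr AM, tr BM) a given point form a
     line of direction S, which contains a positive semidefinite M = x x^T;
     hence the range is the whole plane.
   - If det S = 0 and S <> 0, then S = +- w w^T up to scaling, so F_H(w) = 0
     and, for z orthogonal to w, F_H(s w + t z) = s t P + t^2 Q with P, Q
     independent: P is a limit point of the range outside the range. *)

Set Implicit Arguments.
Unset Strict Implicit.
Unset Printing Implicit Defensive.

Import Order.TTheory GRing.Theory Num.Theory.
Import numFieldNormedType.Exports.

Local Open Scope classical_set_scope.
Local Open Scope ring_scope.

(** * Binary quadratic forms and conjugate bases *)

Definition qform (R : pzRingType) (a b c x y : R) : R :=
  a * x ^+ 2 + 2 * b * x * y + c * y ^+ 2.

Definition polar (R : pzRingType) (a b c x y x' y' : R) : R :=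
  a * x * x' + b * (x * y' + y * x') + c * y * y'.

(** (w1, w2) and (z1, z2) stand for the columns of the diagonalizing matrix. The congruent matrices
    are symmetric, so one off-diagonal entry of each is enough. *)
Definition conjugate_basis (R : pzRingType) (a b c a' b' c' : R) : Prop :=
  exists w1 w2 z1 z2 : R, [/\ w1 * z2 - w2 * z1 != 0,
    polar a b c w1 w2 z1 z2 = 0 & polar a' b' c' w1 w2 z1 z2 = 0].

(** An indefinite form splits into two independent real linear factors w and z. Then w z^T + z w^T
    is a nonzero multiple of S, so the polar forms at (w, z) are multiples of the trace pairings
    with S. *)
Lemma conjugate_basis_of_indefinite (R : rcfType) (a b c a' b' c' p q r : R) :
  p * r - q ^+ 2 < 0 ->
  a * p + 2 * b * q + c * r = 0 -> a' * p + 2 * b' * q + c' * r = 0 ->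
  conjugate_basis a b c a' b' c'.
Proof.
move=> D_lt0 SA SB.
(* w and z are the coefficient vectors of the linear factors of
   p X^2 + 2 q X Y + r Y^2. *)
have [p0|p_neq0] := eqVneq p 0.
  exists 0, 1, (2 * q), r; rewrite /polar; split.
  - have : q != 0.
      by apply: contraTneq D_lt0 => ->; rewrite p0 mul0r expr0n subr0 ltxx.
    by rewrite mul0r sub0r mul1r oppr_eq0 mulf_eq0 pnatr_eq0.
  - by rewrite -[RHS]SA p0; ring.
  - by rewrite -[RHS]SB p0; ring.
pose d := Num.sqrt (q ^+ 2 - p * r).
have d2 : d ^+ 2 = q ^+ 2 - p * r by rewrite sqr_sqrtr //; lra.
have d_neq0 : d != 0 by rewrite gt_eqF // sqrtr_gt0; lra.
exists p, (q + d), p, (q - d); rewrite /polar; split.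
- have -> : p * (q - d) - (q + d) * p = - (2 * p * d) by ring.
  by rewrite oppr_eq0 !mulf_neq0 // pnatr_eq0.
- have -> : a * p * p + b * (p * (q - d) + (q + d) * p) + c * (q + d) * (q - d)
    = p * (a * p + 2 * b * q + c * r) + c * (q ^+ 2 - p * r - d ^+ 2) by ring.
  by rewrite SA d2 subrr !mulr0 addr0.
- have -> : a' * p * p + b' * (p * (q - d) + (q + d) * p) + c' * (q + d) * (q - d)
    = p * (a' * p + 2 * b' * q + c' * r) + c' * (q ^+ 2 - p * r - d ^+ 2) by ring.
  by rewrite SB d2 subrr !mulr0 addr0.
Qed.

(** A trace-free matrix has determinant - (p^2 + q^2), so it suffices to find a nonzero one
    orthogonal to the given matrix. *)
Lemma exists_indefinite_orthogonal (R : realFieldType) (a b c : R) :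
  exists p q r : R, p * r - q ^+ 2 < 0 /\ a * p + 2 * b * q + c * r = 0.
Proof.
(* The sum vanishes exactly for scalar matrices, where the general witness below would be 0; diag(1,
   -1) replaces it. *)
have [/eqP|nz] := eqVneq (b ^+ 2 + (a - c) ^+ 2) 0.
  rewrite paddr_eq0 ?sqr_ge0 // !sqrf_eq0 => /andP[/eqP-> /eqP ac].
  by exists 1, 0, (- 1); split; lra.
exists (2 * b), (c - a), (- (2 * b)); split; last by ring.
have : 0 < b ^+ 2 + (a - c) ^+ 2 by rewrite lt0r nz addr_ge0 ?sqr_ge0.
have := sqr_ge0 b; nra.
Qed.

Lemma conjugate_basis_of_dependent (R : rcfType) (a b c a' b' c' : R) :
  2 * b * c' - 2 * b' * c = 0 -> c * a' - a * c' = 0 ->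
  2 * a * b' - 2 * a' * b = 0 ->
  conjugate_basis a b c a' b' c'.
Proof.
move=> p0 q0 r0.
(* A vanishing cross product means that the first form is zero or the second is a multiple of it.
   Either way only one form is left to be orthogonal to. *)
have [] : (a = 0 /\ b = 0 /\ c = 0) \/
    exists k, [/\ a' = k * a, b' = k * b & c' = k * c].
- have [a0|an] := eqVneq a 0; last first.
    right; exists (a' / a); split; first by rewrite divfK.
      by apply: (mulIf an); rewrite mulrAC divfK //; lra.
    by apply: (mulIf an); rewrite mulrAC divfK //; lra.
  have [b0|bn] := eqVneq b 0; last first.
    right; exists (b' / b); split; last 2 first.
    + by rewrite divfK.
    + by apply: (mulIf bn); rewrite mulrAC divfK //; lra.
    by apply: (mulIf bn); rewrite mulrAC divfK //; nra.
  have [c0|cn] := eqVneq c 0; first by left.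
  right; exists (c' / c); split; last by rewrite divfK.
    by apply: (mulIf cn); rewrite mulrAC divfK //; lra.
  by apply: (mulIf cn); rewrite mulrAC divfK //; nra.
- move=> [-> [-> ->]].
  have [p [q [r [D S]]]] := exists_indefinite_orthogonal a' b' c'.
  by apply: (conjugate_basis_of_indefinite D) => //; ring.
move=> [k [-> -> ->]].
have [p [q [r [D S]]]] := exists_indefinite_orthogonal a b c.
apply: (conjugate_basis_of_indefinite D) => //.
by rewrite -[RHS](mulr0 k) -S; ring.
Qed.

(** * Definite S: every pair of values is attained *)

Lemma psd_rank1 (R : rcfType) (m1 m2 m3 : R) :
  0 <= m1 -> 0 <= m3 -> m1 * m3 = m2 ^+ 2 ->
  exists x y : R, [/\ x ^+ 2 = m1, x * y = m2 & y ^+ 2 = m3].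
Proof.
move=> m1_ge0 m3_ge0 m2E; have [m10|m1n] := eqVneq m1 0.
  exists 0, (Num.sqrt m3); split; rewrite ?sqr_sqrtr //; first by rewrite m10 expr0n.
  by move/eqP: m2E; rewrite m10 mul0r eq_sym sqrf_eq0 => /eqP ->; rewrite mul0r.
have s2 : Num.sqrt m1 ^+ 2 = m1 by rewrite sqr_sqrtr.
have sn : Num.sqrt m1 != 0 by rewrite -sqrf_eq0 s2.
exists (Num.sqrt m1), (m2 / Num.sqrt m1); split=> //.
  by rewrite mulrCA divff // mulr1.
by rewrite expr_div_n s2 -m2E mulrAC divff ?mul1r.
Qed.

(** Along the line M + k S the determinant is the quadratic D k^2 + h k + e, with D > 0. It has real
    roots, and at the larger one the line meets the boundary of the semidefinite cone on its
    positive side. *)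
Lemma pencil_psd_rank1 (R : rcfType) (m1 m2 m3 p q r : R) :
  0 < p -> 0 < p * r - q ^+ 2 ->
  exists k : R, [/\ 0 <= m1 + k * p, 0 <= m3 + k * r &
    (m1 + k * p) * (m3 + k * r) = (m2 + k * q) ^+ 2].
Proof.
move=> p_gt0 D_gt0.
have r_gt0 : 0 < r.
  by rewrite -(pmulr_rgt0 _ p_gt0); have := sqr_ge0 q; lra.
set D := p * r - q ^+ 2 in D_gt0 *.
pose h := m1 * r + m3 * p - 2 * m2 * q.
pose e := m1 * m3 - m2 ^+ 2.
(* Reverse Cauchy-Schwarz: the determinant has signature (1,2) on symmetric
   matrices. *)
have disc_ge0 : 0 <= h ^+ 2 - 4 * D * e.
  have : p ^+ 2 * (h ^+ 2 - 4 * D * e) =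
     (p * (m3 * p - m1 * r) - 2 * q * (p * m2 - q * m1)) ^+ 2
     + 4 * D * (p * m2 - q * m1) ^+ 2 by rewrite /h /e /D; ring.
  move=> E; rewrite -(pmulr_rge0 _ (exprn_gt0 2 p_gt0)) E.
  by rewrite addr_ge0 ?sqr_ge0 // mulr_ge0 ?sqr_ge0 // mulr_ge0 ?ltW.
pose s := Num.sqrt (h ^+ 2 - 4 * D * e).
have s2 : s ^+ 2 = h ^+ 2 - 4 * D * e by rewrite sqr_sqrtr.
have s_ge0 : 0 <= s by rewrite sqrtr_ge0.
(* The larger root of D k^2 + h k + e. *)
pose k := (s - h) / (2 * D).
have kE : 2 * D * k = s - h by rewrite mulrC divfK // mulf_neq0 ?pnatr_eq0 ?gt_eqF.
have det0 : (m1 + k * p) * (m3 + k * r) = (m2 + k * q) ^+ 2.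
  apply/eqP; rewrite -subr_eq0; apply/eqP.
  have D4 : 4 * D != 0 by rewrite mulf_neq0 ?pnatr_eq0 ?gt_eqF.
  apply: (mulfI D4); rewrite mulr0.
  have -> : 4 * D * ((m1 + k * p) * (m3 + k * r) - (m2 + k * q) ^+ 2)
     = (2 * D * k + h) ^+ 2 - (h ^+ 2 - 4 * D * e) by rewrite /h /e /D; ring.
  by rewrite kE subrK s2 subrr.
(* This is the derivative 2 D k + h of the determinant at the root, also the trace of (M + k S)
   adj(S). Its sign tells positive from negative semidefinite. *)
have slope : 0 <= (m1 + k * p) * r + (m3 + k * r) * p - 2 * (m2 + k * q) * q.
  suff -> : (m1 + k * p) * r + (m3 + k * r) * p - 2 * (m2 + k * q) * q = s by [].
  by rewrite -[RHS](subrK h) -kE /h /D; ring.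
exists k; move: det0 slope.
move: (m1 + k * p) (m2 + k * q) (m3 + k * r) => n1 n2 n3 det0 slope.
(* Completing the square, and using that N is singular, p * slope * n1 is a sum of squares with
   nonnegative weights. So n1 >= 0 if the slope is positive, and n1 = 0 if the slope is zero. *)
have n1_ge0 : 0 <= n1.
  have : 0 <= p * ((n1 * r + n3 * p - 2 * n2 * q) * n1).
    have -> : p * ((n1 * r + n3 * p - 2 * n2 * q) * n1) =
      D * n1 ^+ 2 + (p * n2 - q * n1) ^+ 2 + p ^+ 2 * (n1 * n3 - n2 ^+ 2)
      by rewrite /D; ring.
    by rewrite det0 subrr mulr0 addr0 addr_ge0 ?sqr_ge0 // mulr_ge0 ?sqr_ge0 // ltW.
  rewrite pmulr_rge0 //.
  move: slope; rewrite le_eqVlt => /predU1P[s0|spos]; last by rewrite pmulr_rge0.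
  move=> _; suff : n1 = 0 by move->.
  apply/eqP; rewrite -sqrf_eq0 -(mulrI_eq0 _ (lregP (lt0r_neq0 D_gt0))) eq_le.
  apply/andP; split; last by rewrite mulr_ge0 ?sqr_ge0 ?ltW.
  have : D * n1 ^+ 2 + (p * n2 - q * n1) ^+ 2 + p ^+ 2 * (n1 * n3 - n2 ^+ 2)
     = p * ((n1 * r + n3 * p - 2 * n2 * q) * n1) by rewrite /D; ring.
  rewrite -s0 det0 subrr; have := sqr_ge0 (p * n2 - q * n1); lra.
split=> //.
have [n10|n1n] := eqVneq n1 0.
  have /eqP : n2 ^+ 2 = 0 by rewrite -det0 n10 mul0r.
  rewrite sqrf_eq0 => /eqP n20; move: slope; rewrite n10 n20.
  by rewrite mul0r add0r mulr0 mul0r subr0 pmulr_lge0.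
by rewrite -(@pmulr_rge0 _ n1) ?det0 ?sqr_ge0 // lt0r n1n.
Qed.

Lemma qform_pair_solve (R : rcfType) (a b c a' b' c' p q r s t : R) :
  p = 2 * b * c' - 2 * b' * c -> q = c * a' - a * c' ->
  r = 2 * a * b' - 2 * a' * b -> 0 < p * r - q ^+ 2 ->
  exists x y : R, qform a b c x y = s /\ qform a' b' c' x y = t.
Proof.
move=> pE qE rE D_gt0.
have SA : a * p + 2 * b * q + c * r = 0 by rewrite pE qE rE; ring.
have SB : a' * p + 2 * b' * q + c' * r = 0 by rewrite pE qE rE; ring.
pose N := p ^+ 2 + q ^+ 2 + r ^+ 2.
have p_neq0 : p != 0.
  apply: contraTneq D_gt0 => ->; rewrite mul0r sub0r oppr_gt0 -leNgt; exact: sqr_ge0.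
have N_neq0 : N != 0.
  rewrite gt_eqF // /N -addrA ltr_wpDr ?addr_ge0 ?sqr_ge0 //.
  by rewrite lt0r sqrf_eq0 p_neq0 sqr_ge0.
(* With alpha = (a, 2b, c), beta = (a', 2b', c') and n = alpha x beta, the vector (s (beta x n) + t
   (n x alpha)) / |n|^2 is the solution of alpha.m = s, beta.m = t orthogonal to n. *)
pose m1 := (s * (2 * b' * r - c' * q) + t * (q * c - r * (2 * b))) / N.
pose m2 := (s * (c' * p - a' * r) + t * (r * a - p * c)) / N.
pose m3 := (s * (a' * q - 2 * b' * p) + t * (p * (2 * b) - q * a)) / N.
have MA : a * m1 + 2 * b * m2 + c * m3 = s.
  rewrite /m1 /m2 /m3 !mulrA -!mulrDl; apply: (mulIf N_neq0).
  by rewrite divfK // /N pE qE rE; ring.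
have MB : a' * m1 + 2 * b' * m2 + c' * m3 = t.
  rewrite /m1 /m2 /m3 !mulrA -!mulrDl; apply: (mulIf N_neq0).
  by rewrite divfK // /N pE qE rE; ring.
suff [k [x [y [x2 xy y2]]]] : exists k x y : R, [/\ x ^+ 2 = m1 + k * p,
    x * y = m2 + k * q & y ^+ 2 = m3 + k * r].
  exists x, y; rewrite /qform -!(mulrA _ x y) x2 xy y2; split.
    by rewrite -[RHS]addr0 -MA -[X in _ = _ + X](mulr0 k) -SA; ring.
  by rewrite -[RHS]addr0 -MB -[X in _ = _ + X](mulr0 k) -SB; ring.
have [p_gt0|p_le0] := ltP 0 p.
  have [k [h1 h3 h2]] := pencil_psd_rank1 m1 m2 m3 p_gt0 D_gt0.
  by exists k; apply: psd_rank1.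
(* S is negative definite here, so the pencil is taken along - S. *)
have Np : 0 < - p by rewrite oppr_gt0 lt_neqAle p_neq0.
have ND : 0 < - p * - r - (- q) ^+ 2 by rewrite mulrNN sqrrN.
have [k [h1 h3 h2]] := pencil_psd_rank1 m1 m2 m3 Np ND.
exists (- k); rewrite !mulNr -!mulrN; exact: psd_rank1.
Qed.

(** * Values on combinations, and the kernel direction of a singular S *)

Lemma qform_combination (R : comPzRingType) (a b c w1 w2 z1 z2 s t : R) :
  qform a b c (s * w1 + t * z1) (s * w2 + t * z2) =
  s ^+ 2 * qform a b c w1 w2 + t ^+ 2 * qform a b c z1 z2
  + 2 * s * t * polar a b c w1 w2 z1 z2.
Proof. by rewrite /qform /polar; ring. Qed.

(** S has rank one: a nonzero multiple of it is w w^T, with w = (p, q) or, if p = 0, w = (0, r).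
    Pairing with S is thus evaluation at w up to scaling. That S does not vanish at w gives the
    independence of P and Q later. *)
Lemma isotropic_of_degenerate (R : realDomainType) (p q r : R) :
  p * r = q ^+ 2 -> (p, q, r) != 0 ->
  exists w1 w2 : R, qform p q r w1 w2 != 0 /\
    forall a b c, a * p + 2 * b * q + c * r = 0 -> qform a b c w1 w2 = 0.
Proof.
move=> D0 S0; have [p0|pn] := eqVneq p 0.
  have q0 : q = 0 by apply/eqP; rewrite -sqrf_eq0 -D0 p0 mul0r.
  have rn : r != 0 by apply: contraNneq S0 => ->; rewrite p0 q0.
  exists 0, r; rewrite /qform p0 q0; split.
    by rewrite !(mul0r, mulr0, add0r) mulf_neq0 ?sqrf_eq0.
  move=> a b c; rewrite !mulr0 !add0r expr0n mulr0 mul0r !add0r => cr0.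
  by rewrite expr2 mulrA cr0 mul0r.
exists p, q; rewrite /qform; split; last first.
  move=> a b c S; rewrite -[RHS](mulr0 p) -S -D0; ring.
rewrite -(mulrI_eq0 _ (lregP pn)).
have -> : p * (p * p ^+ 2 + 2 * q * p * q + r * q ^+ 2) =
  (p ^+ 2 + q ^+ 2) ^+ 2 + q ^+ 2 * (p * r - q ^+ 2) by ring.
rewrite D0 subrr mulr0 addr0 sqrf_eq0 paddr_eq0 ?sqr_ge0 // sqrf_eq0.
by rewrite (negbTE pn).
Qed.

(** * Coordinates for vectors, congruences, ranges and sums of rays *)

Lemma dotv2E (R : realType) (x y : 'cV[R]_2) :
  dotv x y = x 0 0 * y 0 0 + x 1 0 * y 1 0.
Proof.
rewrite /dotv !big_ord_recl big_ord0 addr0.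
by congr (_ + x _ _ * y _ _); apply/val_inj.
Qed.

Lemma cV2P (T : Type) (x y : 'cV[T]_2) :
  x 0 0 = y 0 0 -> x 1 0 = y 1 0 -> x = y.
Proof.
move=> e0 e1; apply/colP => i; case: (unliftP 0 i) => [j|] -> //.
by rewrite ord1 (_ : lift 0 0 = 1) //; apply/val_inj.
Qed.

Section PlanePoints.
Variable R : realType.
Implicit Types (A B C : 'M[R]_2) (u v : 'cV[R]_2).

Definition point (s t : R) : 'cV[R]_2 := \col_(i < 2) (if i == 0 then s else t).

Lemma point_eta (x : 'cV[R]_2) : x = point (x 0 0) (x 1 0).
Proof. by apply: cV2P; rewrite mxE. Qed.

Lemma mulmx2E (m n : nat) (A : 'M[R]_(m, 2)) (B : 'M[R]_(2, n)) i j :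
  (A *m B) i j = A i 0 * B 0 j + A i 1 * B 1 j.
Proof.
rewrite mxE !big_ord_recl big_ord0 addr0.
by congr (_ + A _ _ * B _ _); apply/val_inj.
Qed.

Lemma det2E A : \det A = A 0 0 * A 1 1 - A 0 1 * A 1 0.
Proof.
rewrite (expand_det_row _ 0) !big_ord_recl big_ord0 addr0 /cofactor !det_mx11 !mxE.
have -> : lift ord0 ord0 = 1 :> 'I_2 by apply/val_inj.
have -> : lift 1 0 = 0 :> 'I_2 by apply/val_inj.
by rewrite /= expr0 expr1 mul1r mulN1r mulrN.
Qed.

Lemma congruence_entry A C i j : A^T = A ->
  (C^T *m A *m C) i j = polar (A 0 0) (A 0 1) (A 1 1) (C 0 i) (C 1 i) (C 0 j) (C 1 j).
Proof.
move=> symA; rewrite !mulmx2E !mxE /polar.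
have -> : A 1 0 = A 0 1 by rewrite -[in LHS]symA mxE.
ring.
Qed.

Lemma SD2P A B : A^T = A -> B^T = B ->
  SD A B <-> conjugate_basis (A 0 0) (A 0 1) (A 1 1) (B 0 0) (B 0 1) (B 1 1).
Proof.
split.
  move=> [C [C_unit /is_diag_mxP CA /is_diag_mxP CB]].
  exists (C 0 0), (C 1 0), (C 0 1), (C 1 1); split.
  - by move: C_unit; rewrite unitmxE unitfE det2E [C 0 1 * _]mulrC.
  - by rewrite -congruence_entry // CA.
  - by rewrite -congruence_entry // CB.
move=> [w1 [w2 [z1 [z2 [wz wAz wBz]]]]].
pose C : 'M[R]_2 := \matrix_(i, j)
  if i == 0 then if j == 0 then w1 else z1 else if j == 0 then w2 else z2.
have diag M : M^T = M -> polar (M 0 0) (M 0 1) (M 1 1) w1 w2 z1 z2 = 0 ->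
    is_diag_mx (C^T *m M *m C).
  move=> symM wMz; apply/is_diag_mxP => i j ij.
  have zMw : polar (M 0 0) (M 0 1) (M 1 1) z1 z2 w1 w2 = 0.
    by rewrite -wMz /polar; ring.
  rewrite congruence_entry // !mxE.
  by case: i j ij => [[|[|//]] ?] [[|[|//]] ?].
exists C; split; [|exact: diag|exact: diag].
by rewrite unitmxE unitfE det2E !mxE /= [z1 * _]mulrC.
Qed.

Lemma FHE A B (x : 'cV[R]_2) : A^T = A -> B^T = B -> FH A B x =
  point (qform (A 0 0) (A 0 1) (A 1 1) (x 0 0) (x 1 0))
        (qform (B 0 0) (B 0 1) (B 1 1) (x 0 0) (x 1 0)).
Proof.
move=> symA symB; have A10 : A 1 0 = A 0 1 by rewrite -[in LHS]symA mxE.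
have B10 : B 1 0 = B 0 1 by rewrite -[in LHS]symB mxE.
by apply: cV2P; rewrite !mxE /= dotv2E !mulmx2E /qform ?A10 ?B10; ring.
Qed.

Lemma range_FHP A B (symA : A^T = A) (symB : B^T = B) (s t : R) :
  range (FH A B) (point s t) <-> exists x y,
    qform (A 0 0) (A 0 1) (A 1 1) x y = s /\ qform (B 0 0) (B 0 1) (B 1 1) x y = t.
Proof.
split.
  move=> [x _]; rewrite FHE // => e; exists (x 0 0), (x 1 0); split.
    by have := congr1 (fun M => fun_of_matrix M 0 0) e; rewrite !mxE.
  by have := congr1 (fun M => fun_of_matrix M 1 0) e; rewrite !mxE.
move=> [x [y [<- <-]]]; exists (point x y) => //.
by rewrite FHE // !mxE.
Qed.

Lemma ray_sumP u v (s t : R) : minkowski_sum (ray u) (ray v) (point s t) <->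
  exists k l, [/\ 0 <= k, 0 <= l, k * u 0 0 + l * v 0 0 = s & k * u 1 0 + l * v 1 0 = t].
Proof.
split.
  move=> [_ [k k0 <-] [_ [l l0 <-] e]]; exists k, l; split=> //.
    by have := congr1 (fun M => fun_of_matrix M 0 0) e; rewrite !mxE.
  by have := congr1 (fun M => fun_of_matrix M 1 0) e; rewrite !mxE.
move=> [k [l [k0 l0 <- <-]]]; exists (k *: u); first by exists k.
exists (l *: v); first by exists l.
by apply: cV2P; rewrite !mxE.
Qed.

(** In a conjugate basis F_H(s w + t z) = s^2 F_H(w) + t^2 F_H(z), and the squares are exactly the
    nonnegative reals. *)
Lemma ray_sum_of_conjugate_basis A B : A^T = A -> B^T = B ->
  conjugate_basis (A 0 0) (A 0 1) (A 1 1) (B 0 0) (B 0 1) (B 1 1) ->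
  exists u v : 'cV[R]_2, range (FH A B) = minkowski_sum (ray u) (ray v).
Proof.
move=> symA symB [w1 [w2 [z1 [z2 [wz wAz wBz]]]]].
exists (FH A B (point w1 w2)), (FH A B (point z1 z2)).
apply/seteqP; split=> y; rewrite [y]point_eta.
  move=> /(range_FHP symA symB) [x1 [x2 [<- <-]]]; apply/ray_sumP.
  (* Cramer's rule in the basis (w, z). *)
  pose s := (x1 * z2 - x2 * z1) / (w1 * z2 - w2 * z1).
  pose t := (w1 * x2 - w2 * x1) / (w1 * z2 - w2 * z1).
  have -> : x1 = s * w1 + t * z1 by rewrite /s /t; field.
  have -> : x2 = s * w2 + t * z2 by rewrite /s /t; field.
  exists (s ^+ 2), (t ^+ 2); rewrite !sqr_ge0 !qform_combination wAz wBz !FHE // !mxE /=.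
  by rewrite !mulr0 !addr0.
move=> /ray_sumP [k [l [k0 l0 <- <-]]]; apply/range_FHP => //.
exists (Num.sqrt k * w1 + Num.sqrt l * z1), (Num.sqrt k * w2 + Num.sqrt l * z2).
by rewrite !qform_combination !sqr_sqrtr // wAz wBz !FHE // !mxE /= !mulr0 !addr0.
Qed.

(** * Sums of two rays are closed and lie in a half-plane *)

Lemma continuous_linear_form (m n : R) :
  continuous (fun x : 'cV[R]_2 => m * x 0 0 + n * x 1 0).
Proof.
have c i : continuous (fun x : 'cV[R]_2 => x i 0) := @coord_continuous R 2 1 i 0.
move=> x.
exact: cvgD (cvgM (cvg_cst m) (c 0 x)) (cvgM (cvg_cst n) (c 1 x)).
Qed.

Lemma closed_half_plane (m n : R) : closed [set x : 'cV[R]_2 | 0 <= m * x 0 0 + n * x 1 0].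
Proof.
apply: (@preimage_closed _ _ (fun x : 'cV[R]_2 => m * x 0 0 + n * x 1 0) [set t | 0 <= t]).
  by move=> x _; exact: continuous_linear_form.
exact: closed_ge.
Qed.

Lemma closed_line_through_0 (m n : R) :
  closed [set x : 'cV[R]_2 | m * x 0 0 + n * x 1 0 = 0].
Proof.
apply: (@preimage_closed _ _ (fun x : 'cV[R]_2 => m * x 0 0 + n * x 1 0) [set t | t = 0]).
  by move=> x _; exact: continuous_linear_form.
exact: closed_eq.
Qed.

Lemma half_plane_ray_sum u v : exists m n : R, (m, n) != 0 /\
  minkowski_sum (ray u) (ray v) `<=` [set x | 0 <= m * x 0 0 + n * x 1 0].
Proof.
suff [m [n [mn [u0 v0]]]] : exists m n : R, (m, n) != 0 /\
    0 <= m * u 0 0 + n * u 1 0 /\ 0 <= m * v 0 0 + n * v 1 0.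
  exists m, n; split=> // y; rewrite [y]point_eta => /ray_sumP [k [l [k0 l0 <- <-]]].
  rewrite /= !mxE /=.
  have -> : m * (k * u 0 0 + l * v 0 0) + n * (k * u 1 0 + l * v 1 0) =
    k * (m * u 0 0 + n * u 1 0) + l * (m * v 0 0 + n * v 1 0) by ring.
  by rewrite addr_ge0 ?mulr_ge0.
have [v0|vn] := eqVneq (v 0 0, v 1 0) 0.
  case: v0 => -> ->; have [u0|un] := eqVneq (u 0 0, u 1 0) 0.
    by case: u0 => -> ->; exists 1, 0; rewrite !mulr0 addr0 xpair_eqE oner_eq0.
  exists (u 0 0), (u 1 0); split=> //; rewrite !mulr0 addr0 -!expr2.
  by rewrite addr_ge0 ?sqr_ge0.
(* A normal to v vanishes on v; the sign of the determinant selects the one of the two orientations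
   that is nonnegative on u. *)
have [d0|d0] := leP 0 (v 0 0 * u 1 0 - v 1 0 * u 0 0).
  exists (- v 1 0), (v 0 0); split; last by split; lra.
  by apply: contraNneq vn => -[/eqP]; rewrite oppr_eq0 => /eqP -> ->.
exists (v 1 0), (- v 0 0); split; last by split; lra.
by apply: contraNneq vn => -[-> /eqP]; rewrite oppr_eq0 => /eqP ->.
Qed.

Lemma ray_sum_neqT u v : minkowski_sum (ray u) (ray v) <> [set: 'cV[R]_2].
Proof.
have [m [n [mn sub]]] := half_plane_ray_sum u v => E.
have /sub : minkowski_sum (ray u) (ray v) (point (- m) (- n)) by rewrite E.
rewrite /= !mxE /= !mulrN -!expr2 -opprD oppr_ge0 => le0.
have := addr_ge0 (sqr_ge0 m) (sqr_ge0 n).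
rewrite le_eqVlt ltNge le0 orbF eq_sym paddr_eq0 ?sqr_ge0 // !sqrf_eq0.
by move: mn; rewrite xpair_eqE => /negP.
Qed.

Lemma rayP u (s t : R) :
  ray u (point s t) <-> exists k, [/\ 0 <= k, k * u 0 0 = s & k * u 1 0 = t].
Proof.
split.
  move=> [k k0 e]; exists k; split=> //.
    by have := congr1 (fun M => fun_of_matrix M 0 0) e; rewrite !mxE.
  by have := congr1 (fun M => fun_of_matrix M 1 0) e; rewrite !mxE.
by move=> [k [k0 <- <-]]; exists k => //; apply: cV2P; rewrite !mxE.
Qed.

(** For u nonzero the ray is the part of the line through u on which the inner product with u is
    nonnegative; for u = 0 it is the intersection of the two axes. *)
Lemma closed_ray u : closed (ray u).
Proof.
have [u0|un] := eqVneq (u 0 0 ^+ 2 + u 1 0 ^+ 2) 0.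
  move: u0 => /eqP; rewrite paddr_eq0 ?sqr_ge0 // !sqrf_eq0 => /andP[/eqP u0 /eqP u1].
  have -> : ray u = [set x | 1 * x 0 0 + 0 * x 1 0 = 0] `&`
      [set x | 0 * x 0 0 + 1 * x 1 0 = 0].
    apply/seteqP; split=> y; rewrite [y]point_eta.
      by move=> /rayP [k [_ <- <-]]; rewrite u0 u1; split; rewrite /= !mxE /=; ring.
    rewrite /= !mxE /= !mul0r !mul1r add0r addr0 => -[-> ->].
    by apply/rayP; exists 0; rewrite !mul0r.
  by apply: closedI; exact: closed_line_through_0.
have -> : ray u = [set x | - u 1 0 * x 0 0 + u 0 0 * x 1 0 = 0] `&`
    [set x | 0 <= u 0 0 * x 0 0 + u 1 0 * x 1 0].
  apply/seteqP; split=> y; rewrite [y]point_eta.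
    move=> /rayP [k [k0 <- <-]]; split; rewrite /= !mxE /=; first by ring.
    have -> : u 0 0 * (k * u 0 0) + u 1 0 * (k * u 1 0) = k * (u 0 0 ^+ 2 + u 1 0 ^+ 2) by ring.
    by rewrite mulr_ge0 // addr_ge0 ?sqr_ge0.
  move: (y 0 0) (y 1 0) => s t; rewrite /= !mxE /= => -[line side]; apply/rayP.
  exists ((u 0 0 * s + u 1 0 * t) / (u 0 0 ^+ 2 + u 1 0 ^+ 2)); split.
  - by rewrite divr_ge0 // addr_ge0 ?sqr_ge0.
  - apply: (mulIf un); rewrite mulrAC divfK //; apply/eqP; rewrite -subr_eq0.
    by apply/eqP; rewrite -[RHS](mulr0 (u 1 0)) -line; ring.
  - apply: (mulIf un); rewrite mulrAC divfK //; apply/eqP; rewrite -subr_eq0.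
    by apply/eqP; rewrite -[RHS](mulr0 (- u 0 0)) -line; ring.
by apply: closedI; [exact: closed_line_through_0|exact: closed_half_plane].
Qed.

Lemma ray_sum_collinear u (k : R) : 0 <= k ->
  minkowski_sum (ray u) (ray (k *: u)) = ray u.
Proof.
move=> k0; apply/seteqP; split=> y; rewrite [y]point_eta.
  move=> /ray_sumP [l [m [l0 m0 <- <-]]]; apply/rayP; exists (l + m * k).
  by rewrite addr_ge0 ?mulr_ge0 // !mxE !mulrDl !mulrA.
move=> /rayP [l [l0 <- <-]]; apply/ray_sumP; exists l, 0.
by rewrite !mul0r !addr0.
Qed.

Lemma closed_ray_sum_opposite u (k : R) : k < 0 ->
  closed (minkowski_sum (ray u) (ray (k *: u))).
Proof.
move=> k0; have [u0|un] := eqVneq (u 0 0 ^+ 2 + u 1 0 ^+ 2) 0.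
  (* Both vectors are zero, so the sum is again a single ray. *)
  have -> : k *: u = 1 *: u.
    move: u0 => /eqP; rewrite paddr_eq0 ?sqr_ge0 // !sqrf_eq0 => /andP[/eqP u0 /eqP u1].
    by apply: cV2P; rewrite !mxE ?u0 ?u1 !mulr0.
  by rewrite ray_sum_collinear //; exact: closed_ray.
have -> : minkowski_sum (ray u) (ray (k *: u)) =
    [set x | - u 1 0 * x 0 0 + u 0 0 * x 1 0 = 0].
  apply/seteqP; split=> y; rewrite [y]point_eta.
    by move=> /ray_sumP [l [m [_ _ <- <-]]]; rewrite /= !mxE /=; ring.
  move: (y 0 0) (y 1 0) => s t; rewrite /= !mxE /= => line; apply/ray_sumP.
  pose h := (u 0 0 * s + u 1 0 * t) / (u 0 0 ^+ 2 + u 1 0 ^+ 2).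
  have hs : h * u 0 0 = s.
    apply: (mulIf un); rewrite mulrAC divfK //; apply/eqP; rewrite -subr_eq0.
    by apply/eqP; rewrite -[RHS](mulr0 (u 1 0)) -line; ring.
  have ht : h * u 1 0 = t.
    apply: (mulIf un); rewrite mulrAC divfK //; apply/eqP; rewrite -subr_eq0.
    by apply/eqP; rewrite -[RHS](mulr0 (- u 0 0)) -line; ring.
  have [h0|h0] := leP 0 h.
    by exists h, 0; rewrite !mul0r !addr0.
  exists 0, (h / k); rewrite !mxE !mul0r !add0r !mulrA divfK ?lt_eqF //; split=> //.
  by rewrite ltW // nmulr_rgt0 // invr_lt0.
exact: closed_line_through_0.
Qed.

Lemma minkowski_sumC (n : nat) (X Y : set 'cV[R]_n) :
  minkowski_sum X Y = minkowski_sum Y X.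
Proof.
by apply/seteqP; split=> _ [x Xx [y Yy <-]]; exists y => //; exists x => //; rewrite addrC.
Qed.

(** Dependent vectors give a ray or a line. Independent ones give the intersection of the two
    half-planes on which the coordinates in the basis (u, v) are nonnegative. *)
Lemma closed_ray_sum u v : closed (minkowski_sum (ray u) (ray v)).
Proof.
have [d0|dn] := eqVneq (u 0 0 * v 1 0 - u 1 0 * v 0 0) 0.
  have [u0|un] := eqVneq u 0.
    rewrite minkowski_sumC u0 -(scale0r v) ray_sum_collinear //; exact: closed_ray.
  suff [k ->] : exists k, v = k *: u.
    have [k0|k0] := leP 0 k; last exact: closed_ray_sum_opposite.
    rewrite ray_sum_collinear //; exact: closed_ray.
  have [u0|u0] := eqVneq (u 0 0) 0.
    have u1 : u 1 0 != 0.
      by apply: contra_neq un => u1; apply: cV2P; rewrite mxE.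
    exists (v 1 0 / u 1 0); apply: cV2P; rewrite !mxE ?divfK // u0 mulr0.
    by apply: (mulfI u1); rewrite mulr0; move: d0; rewrite u0; lra.
  exists (v 0 0 / u 0 0); apply: cV2P; rewrite !mxE ?divfK //.
  by apply: (mulIf u0); rewrite mulrAC divfK //; lra.
set d := (X in X != 0) in dn.
have -> : minkowski_sum (ray u) (ray v) =
    [set x | 0 <= v 1 0 / d * x 0 0 + (- v 0 0 / d) * x 1 0] `&`
    [set x | 0 <= - u 1 0 / d * x 0 0 + u 0 0 / d * x 1 0].
  apply/seteqP; split=> y; rewrite [y]point_eta.
    move=> /ray_sumP [k [l [k0 l0 <- <-]]]; split; rewrite /= !mxE /=.
      by rewrite [leRHS](_ : _ = k) // /d; field.
    by rewrite [leRHS](_ : _ = l) // /d; field.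
  move=> []; rewrite /= !mxE /= => h1 h2; apply/ray_sumP.
  by do 2!eexists; split; [exact: h1|exact: h2|rewrite /d; field|rewrite /d; field].
by apply: closedI; exact: closed_half_plane.
Qed.

(** * Nonzero singular S: a limit point that is missed *)

Lemma not_closed_range_of_degenerate A B (p q r : R) : A^T = A -> B^T = B ->
  p = 2 * A 0 1 * B 1 1 - 2 * B 0 1 * A 1 1 -> q = A 1 1 * B 0 0 - A 0 0 * B 1 1 ->
  r = 2 * A 0 0 * B 0 1 - 2 * B 0 0 * A 0 1 ->
  p * r = q ^+ 2 -> (p, q, r) != 0 -> ~ closed (range (FH A B)).
Proof.
move=> symA symB; move: (@range_FHP A B symA symB).
move: (A 0 0) (A 0 1) (A 1 1) (B 0 0) (B 0 1) (B 1 1).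
move=> a b c a' b' c' rangeP pE qE rE D0 S0 cl.
have SA : a * p + 2 * b * q + c * r = 0 by rewrite pE qE rE; ring.
have SB : a' * p + 2 * b' * q + c' * r = 0 by rewrite pE qE rE; ring.
have [w1 [w2 [wn iso]]] := isotropic_of_degenerate D0 S0.
have Aw := iso _ _ _ SA; have Bw := iso _ _ _ SB.
have nw : w1 ^+ 2 + w2 ^+ 2 != 0.
  apply: contraNneq wn => /eqP.
  rewrite paddr_eq0 ?sqr_ge0 // !sqrf_eq0 /qform => /andP[/eqP-> /eqP->].
  by apply/eqP; ring.
(* Here z = (- w2, w1) is w turned by a right angle; the factor 2 is that of the cross term in
   [qform_combination]. *)
pose P := point (2 * polar a b c w1 w2 (- w2) w1) (2 * polar a' b' c' w1 w2 (- w2) w1).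
pose Q := point (qform a b c (- w2) w1) (qform a' b' c' (- w2) w1).
have indep : P 0 0 * Q 1 0 - P 1 0 * Q 0 0 != 0.
  have -> : P 0 0 * Q 1 0 - P 1 0 * Q 0 0 = (w1 ^+ 2 + w2 ^+ 2) * qform p q r w1 w2.
    by rewrite !mxE /= pE qE rE /polar /qform; ring.
  by rewrite mulf_neq0.
(* P + t Q is the value at s^-1 w + s z with s^2 = t: the preimages escape to infinity while the
   values tend to P. *)
have inner : \forall t \near 0^'+, range (FH A B) (P + t *: Q).
  near=> t; have t0 : 0 < t by near: t; exact: nbhs_right_gt.
  pose s := Num.sqrt t; have s2 : s ^+ 2 = t by rewrite sqr_sqrtr // ltW.
  have sn : s != 0 by rewrite -sqrf_eq0 s2 gt_eqF.
  rewrite [_ + _]point_eta; apply/rangeP.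
  exists (s^-1 * w1 + s * - w2), (s^-1 * w2 + s * w1).
  rewrite !qform_combination Aw Bw !mxE /= -s2.
  by split; field.
have lim : P + t *: Q @[t --> 0^'+] --> P.
  apply: cvg_at_right_filter; rewrite -[X in _ --> X]addr0 -(scale0r Q).
  exact: cvgD (cvg_cst P) (@scalel_continuous _ _ Q 0).
have PF : range (FH A B) (point (P 0 0) (P 1 0)).
  by rewrite -point_eta; exact: closed_cvg cl inner _ lim.
have [x [y [Px Py]]] := (rangeP _ _).1 PF.
pose s := (x * w1 + y * w2) / (w1 ^+ 2 + w2 ^+ 2).
pose t := (y * w1 - x * w2) / (w1 ^+ 2 + w2 ^+ 2).
have xE : x = s * w1 + t * - w2 by rewrite /s /t; field.
have yE : y = s * w2 + t * w1 by rewrite /s /t; field.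
(* P = s t P + t^2 Q in coordinates. Independence forces t = 0, and then P = 0, which contradicts
   independence. *)
have eqP0 : (s * t - 1) * P 0 0 + t ^+ 2 * Q 0 0 = 0.
  by move: Px; rewrite xE yE qform_combination Aw !mxE /=; lra.
have eqP1 : (s * t - 1) * P 1 0 + t ^+ 2 * Q 1 0 = 0.
  by move: Py; rewrite xE yE qform_combination Bw !mxE /=; lra.
have t0 : t = 0.
  apply/eqP; rewrite -sqrf_eq0 -(mulrI_eq0 _ (lregP indep)); apply/eqP.
  transitivity (P 0 0 * ((s * t - 1) * P 1 0 + t ^+ 2 * Q 1 0)
    - P 1 0 * ((s * t - 1) * P 0 0 + t ^+ 2 * Q 0 0)); first by ring.
  by rewrite eqP0 eqP1 !mulr0 subr0.
move: indep; have -> : P 0 0 = 0 by move: eqP0; rewrite t0; lra.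
have -> : P 1 0 = 0 by move: eqP1; rewrite t0; lra.
by rewrite !mul0r subr0 eqxx.
Unshelve. all: by end_near.
Qed.

(** The sign of det S decides: missing a point excludes det S > 0, closedness excludes a nonzero
    singular S, and the remaining cases have a conjugate basis. *)
Lemma conjugate_basis_of_closed_range A B : A^T = A -> B^T = B ->
  closed (range (FH A B)) -> range (FH A B) <> [set: 'cV[R]_2] ->
  conjugate_basis (A 0 0) (A 0 1) (A 1 1) (B 0 0) (B 0 1) (B 1 1).
Proof.
move=> symA symB cl neT.
pose p := 2 * A 0 1 * B 1 1 - 2 * B 0 1 * A 1 1.
pose q := A 1 1 * B 0 0 - A 0 0 * B 1 1.
pose r := 2 * A 0 0 * B 0 1 - 2 * B 0 0 * A 0 1.
have [D_lt0|D_gt0|D0] := ltgtP (p * r - q ^+ 2) 0.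
- by apply: (conjugate_basis_of_indefinite D_lt0); rewrite /p /q /r; ring.
- case: neT; apply/seteqP; split=> // y _; rewrite [y]point_eta.
  by apply/range_FHP => //; exact: (qform_pair_solve (p := p) (q := q) (r := r)).
have [[p0 q0 r0]|S0] := eqVneq (p, q, r) 0; first exact: conjugate_basis_of_dependent.
case: (not_closed_range_of_degenerate (p := p) (q := q) (r := r) symA symB) => //.
by apply/eqP; rewrite -subr_eq0 D0.
Qed.

End PlanePoints.

Theorem theorem3p3 (R : realType) (A B : 'M[R]_2)
    (symA : A^T = A) (symB : B^T = B) :
  (SD A B <->
     exists u v : 'cV[R]_2, range (FH A B) = minkowski_sum (ray u) (ray v)) /\
  ((exists u v : 'cV[R]_2, range (FH A B) = minkowski_sum (ray u) (ray v)) <->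
     closed (range (FH A B)) /\ range (FH A B) <> [set: 'cV[R]_2]).
Proof.
have ab : SD A B ->
    exists u v : 'cV[R]_2, range (FH A B) = minkowski_sum (ray u) (ray v).
  by move=> /(SD2P symA symB); exact: ray_sum_of_conjugate_basis.
have bc : (exists u v : 'cV[R]_2, range (FH A B) = minkowski_sum (ray u) (ray v)) ->
    closed (range (FH A B)) /\ range (FH A B) <> [set: 'cV[R]_2].
  by move=> [u [v ->]]; split; [exact: closed_ray_sum|exact: ray_sum_neqT].
have ca : closed (range (FH A B)) /\ range (FH A B) <> [set: 'cV[R]_2] -> SD A B.
  by move=> [cl neT]; apply/(SD2P symA symB); exact: conjugate_basis_of_closed_range.
by split; split=> h; [exact: ab|exact/ca/bc|exact: bc|exact/ab/ca].
Qed.
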